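(* $\mathrm{supcov}=\mathrm{supaLc}$ and $\mathrm{minnon}=\mathrm{minaLc}$.
   Context: Yorioka ideals: for $\sigma\in(2^{<\omega})^\omega$, $[\sigma]_\infty=\{x\in2^\omega:\exists^\infty n\,(\sigma(n)\subseteq x)\}$, $h_\sigma(i)=|\sigma(i)|$; $f\ll g$ iff $\forall k\,\forall^\infty n\,(f(n^k)\leq g(n))$; $\mathcal{J}_g=\{X\subseteq2^\omega:\exists\sigma\,(X\subseteq[\sigma]_\infty,\ h_\sigma=g)\}$; $\mathcal{I}_f=\bigcup_{g\gg f}\mathcal{J}_g$. $\mathrm{supcov}=\sup\{\mathrm{cov}(\mathcal{I}_f):f\in\omega^\omega\text{ increasing}\}$ and $\mathrm{minnon}=\min\{\mathrm{non}(\mathcal{I}_f):f\in\omega^\omega\text{ increasing}\}$. For $b\in\omega^\omega$, $\mathcal{S}(b,1)=\prod_n[b(n)]^{\leq1}$; $\mathfrak{b}^{\mathrm{aLc}}_{b,1}$ is the least size of $F\subseteq\mathcal{S}(b,1)$ such that no $x\in\prod b$ satisfies, for every $\varphi\in F$, $x(n)\notin\varphi(n)$ for almost all $n$; $\mathfrak{d}^{\mathrm{aLc}}_{b,1}$ is the least size of $D\subseteq\prod b$ such that for every $\varphi\in\mathcal{S}(b,1)$ there is $x\in D$ with $x(n)\notin\varphi(n)$ for almost all $n$. $\mathrm{supaLc}=\sup\{\mathfrak{b}^{\mathrm{aLc}}_{b,1}:b\in\omega^\omega\}$, $\mathrm{minaLc}=\min\{\mathfrak{d}^{\mathrm{aLc}}_{b,1}:b\in\omega^\omega\}$.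 *)

(* Defs.v *)
From mathcomp Require Import all_boot.
From mathcomp Require Import boolp classical_sets functions cardinality.

Set Implicit Arguments.
Unset Strict Implicit.
Unset Printing Implicit Defensive.

Local Open Scope nat_scope.
Local Open Scope classical_set_scope.
Local Open Scope card_scope.

(** * Cardinal numbers *)

(* A cardinal is an equinumerosity class of types, so that equality of
   cardinals is Leibniz equality. Collections of cardinals are plain predicates
   rather than [set cardinal]: [cardinal] lives one universe above the types it
   classifies, and [set] is not universe polymorphic. *)
Record cardinal := Cardinal {
  card_class : Type -> Prop;
  card_classP : exists T : Type, card_class = (fun U => [set: U] #= [set: T])
}.

Lemma card_proof (T : Type) (A : set T) :
  exists V : Type, (fun U : Type => [set: U] #= A : Prop)
                   = (fun U => [set: U] #= [set: V]).
Proof.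
exists A; apply/funext => U.
by rewrite (card_eqr (card_setT A)).
Qed.

Definition card (T : Type) (A : set T) : cardinal :=
  Cardinal (card_proof A).

Definition cardinal_le (k l : cardinal) : Prop :=
  exists T U : Type,
    [/\ card_class k T, card_class l U & [set: T] #<= [set: U]].

Definition is_least (S : cardinal -> Prop) (k : cardinal) : Prop :=
  S k /\ forall l, S l -> cardinal_le k l.

(* The least element of S; it exists as soon as S is inhabited, see
   [cardinal_minP]. The value on the empty collection is junk. *)
Definition cardinal_min (S : cardinal -> Prop) : cardinal :=
  if pselect (exists k, is_least S k) is left e then sval (cid e)
  else card (@set0 nat).

Definition cardinal_sup (S : cardinal -> Prop) : cardinal :=
  cardinal_min (fun k => forall l, S l -> cardinal_le l k).

Lemma cardinal_eq (k l : cardinal) : card_class k = card_class l -> k = l.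
Proof.
case: k l => [C p] [D q] /= CD; subst D.
by congr Cardinal; exact: Prop_irrelevance.
Qed.

Lemma cardinalE (k : cardinal) : exists T : Type, k = card [set: T].
Proof. by case: (card_classP k) => T kT; exists T; exact: cardinal_eq. Qed.

Lemma card_eqE (T U : Type) (A : set T) (B : set U) :
  card A = card B <-> A #= B.
Proof.
split=> [AB|AB].
  have : card_class (card B) A by rewrite -AB /=; exact: card_setT.
  by rewrite /= => h; rewrite -(card_eql (card_setT A)).
apply: cardinal_eq; apply/funext => V /=.
by rewrite (card_eqr AB).
Qed.

Lemma cardinal_leE (T U : Type) (A : set T) (B : set U) :
  cardinal_le (card A) (card B) <-> A #<= B.
Proof.
split=> [[V [W [/= VA WB VW]]]|AB].
  by rewrite -(card_le_eql VA) -(card_le_eqr WB).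
exists A, B; split; [exact: card_setT|exact: card_setT|].
by rewrite (card_le_eql (card_setT A)) (card_le_eqr (card_setT B)).
Qed.

Lemma cardinal_le_anti (k l : cardinal) :
  cardinal_le k l -> cardinal_le l k -> k = l.
Proof.
case: (cardinalE k) => T ->; case: (cardinalE l) => U ->.
by move=> /cardinal_leE h1 /cardinal_leE h2; apply/card_eqE/card_eqPle.
Qed.

Lemma ex_least_card (I T : Type) (A : I -> set T) (i0 : I) :
  exists i, forall j, A i #<= A j.
Proof.
pose P : set (set (I -> T)) := [set X | (forall x, X x -> forall i, A i (x i)) /\
  forall i x y, X x -> X y -> x i = y i -> x = y].
have [F FP Ftot|X [[XA Xinj] Xmax]] := @Zorn_bigcup _ P.
  split=> [x [X FX Xx]|i x y [X FX Xx] [Y FY Yy]].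
    exact: (FP _ FX).1.
  have [XY|YX] := Ftot _ _ FX FY.
    by apply: (FP _ FY).2 => //; exact: XY.
  by apply: (FP _ FX).2 => //; exact: YX.
have [i Ai] : exists i, forall t, A i t -> exists2 x, X x & x i = t.
  apply: contrapT => noi.
  have fresh i : exists t, A i t /\ forall x, X x -> x i <> t.
    apply: contrapT => nt; apply: noi; exists i => t Ait.
    apply: contrapT => nx; apply: nt; exists t; split=> // x Xx xit.
    by apply: nx; exists x.
  have [y yP] := choice fresh.
  apply: (Xmax (X `|` [set y])).
    split=> [x Xx|]; first by left.
    move=> /(_ y) /(_ (or_intror erefl)) Xy.
    by case: (yP i0) => _ /(_ _ Xy).
  split=> [x [Xx|->] i|i u v [Xu|->] [Xv|->] uv //].
  - exact: XA.
  - by case: (yP i).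
  - exact: Xinj uv.
  - by case: (yP i) => _ /(_ _ Xu).
  - by case: (yP i) => _ /(_ _ Xv); rewrite uv.
exists i => j.
have inj k : (fun x => x k) @` X #= X.
  by apply: inj_card_eq => x y /set_mem Xx /set_mem Xy; exact: Xinj.
have -> : A i = (fun x => x i) @` X.
  apply/seteqP; split=> [t /Ai[x Xx <-]|_ [x Xx <-]]; first by exists x.
  exact: XA.
rewrite (card_le_eql (inj i)) -(card_le_eql (inj j)).
by apply: subset_card_le => _ [x Xx <-]; exact: XA.
Qed.

Lemma cardinal_le_total (k l : cardinal) : cardinal_le k l \/ cardinal_le l k.
Proof.
case: (cardinalE k) => T ->; case: (cardinalE l) => U ->.
pose A (b : bool) : set (T + U)%type :=
  if b then inl @` [set: T] else inr @` [set: U].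
have e1 : A true #= [set: T] by apply: inj_card_eq => x y _ _ [].
have e2 : A false #= [set: U] by apply: inj_card_eq => x y _ _ [].
have [[] Ai] := ex_least_card A true.
  left; apply/cardinal_leE.
  by rewrite -(card_le_eql e1) -(card_le_eqr e2); exact: Ai.
right; apply/cardinal_leE.
by rewrite -(card_le_eql e2) -(card_le_eqr e1); exact: Ai.
Qed.

Lemma cardinal_le_trans (k l m : cardinal) :
  cardinal_le k l -> cardinal_le l m -> cardinal_le k m.
Proof.
case: (cardinalE k) => T ->; case: (cardinalE l) => U ->.
case: (cardinalE m) => V -> /cardinal_leE h1 /cardinal_leE h2.
by apply/cardinal_leE; exact: card_le_trans h2.
Qed.

Lemma card_le_sub (T U : Type) (A : set T) (B : set U) :
  A #<= B -> exists2 C : set U, C `<=` B & A #= C.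
Proof.
move=> /card_leP[f].
have finj : injective (fun x : A => sval (f x)).
  by move=> x y /val_inj /(@inj _ _ _ f); apply; exact: mem_setT.
exists ((fun x : A => sval (f x)) @` [set: A]).
  by move=> _ [x _ <-]; exact: set_mem (svalP (f x)).
apply: card_eq_trans (card_setT_sym A) _; apply: card_esym.
by apply: inj_card_eq => x y _ _; exact: finj.
Qed.

Lemma cardinal_minP (S : cardinal -> Prop) (k : cardinal) :
  S k -> is_least S (cardinal_min S).
Proof.
move=> Sk; rewrite /cardinal_min.
case: pselect => [e|[]]; first exact: (svalP (cid e)).
case: (cardinalE k) Sk => T -> ST.
pose I := {A : set T | S (card A)}.
have [[A SA] minA] := ex_least_card (fun i : I => sval i) (exist _ setT ST).
exists (card A); split=> // l Sl.
have [lT|Tl] := cardinal_le_total l (card [set: T]).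
  case: (cardinalE l) Sl lT => U -> SU /cardinal_leE /card_le_sub[B _ /card_eqE UB].
  rewrite UB in SU *.
  by apply/cardinal_leE; exact: (minA (exist _ B SU)).
apply: cardinal_le_trans Tl; apply/cardinal_leE.
exact: (minA (exist _ setT ST)).
Qed.

(** * Quantifiers "for infinitely many" and "for almost all" *)

Definition infinitely_often (P : nat -> Prop) : Prop :=
  forall m, exists2 n, m <= n & P n.

Definition almost_all (P : nat -> Prop) : Prop :=
  exists m, forall n, m <= n -> P n.

(** * Yorioka ideals *)

Definition cantor := nat -> bool.

Definition initial_segment (s : seq bool) (x : cantor) : Prop :=
  forall i, i < size s -> nth false s i = x i.

Definition infty_cap (sigma : nat -> seq bool) : set cantor :=
  [set x | infinitely_often (fun n => initial_segment (sigma n) x)].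

Definition height (sigma : nat -> seq bool) : nat -> nat :=
  fun i => size (sigma i).

Definition much_less (f g : nat -> nat) : Prop :=
  forall k, almost_all (fun n => f (n ^ k) <= g n).

Definition yorioka_J (g : nat -> nat) : set (set cantor) :=
  [set X | exists sigma, X `<=` infty_cap sigma /\ height sigma = g].

Definition yorioka_I (f : nat -> nat) : set (set cantor) :=
  \bigcup_(g in [set g | much_less f g]) yorioka_J g.

Definition increasing (f : nat -> nat) : Prop := {homo f : m n / m < n}.

Definition covers (X : Type) (J F : set (set X)) : Prop :=
  F `<=` J /\ \bigcup_(A in F) A = [set: X].

Definition cov (X : Type) (J : set (set X)) : cardinal :=
  cardinal_min (fun k => exists2 F, covers J F & k = card F).

Definition non (X : Type) (J : set (set X)) : cardinal :=
  cardinal_min (fun k => exists2 A, ~ J A & k = card A).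

Definition supcov : cardinal :=
  cardinal_sup (fun k => exists2 f, increasing f & k = cov (yorioka_I f)).

Definition minnon : cardinal :=
  cardinal_min (fun k => exists2 f, increasing f & k = non (yorioka_I f)).

(** * Anti-localization cardinals *)

Definition prodb (b : nat -> nat) : set (nat -> nat) :=
  [set x | forall n, x n < b n].

Definition slalom1 (b : nat -> nat) : set (nat -> set nat) :=
  [set phi | forall n, phi n `<=` `I_(b n) /\ phi n #<= `I_1].

Definition avoids (x : nat -> nat) (phi : nat -> set nat) : Prop :=
  almost_all (fun n => ~ phi n (x n)).

Definition aLc_unbounded (b : nat -> nat) (F : set (nat -> set nat)) : Prop :=
  F `<=` slalom1 b /\
  ~ exists2 x, prodb b x & forall phi, F phi -> avoids x phi.

Definition aLc_dominating (b : nat -> nat) (D : set (nat -> nat)) : Prop :=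
  D `<=` prodb b /\
  forall phi, slalom1 b phi -> exists2 x, D x & avoids x phi.

Definition b_aLc (b : nat -> nat) : cardinal :=
  cardinal_min (fun k => exists2 F, aLc_unbounded b F & k = card F).

Definition d_aLc (b : nat -> nat) : cardinal :=
  cardinal_min (fun k => exists2 D, aLc_dominating b D & k = card D).

Definition supaLc : cardinal :=
  cardinal_sup (fun k => exists b, k = b_aLc b).

(* If b takes a value <= 1 infinitely often (or the value 0 at all), then no D
   is dominating and d_aLc b is undefined (min of the empty set, i.e. infinity);
   such b do not contribute to the minimum. *)
Definition minaLc : cardinal :=
  cardinal_min (fun k =>
    exists2 b, (exists D, aLc_dominating b D) & k = d_aLc b).

(** * None of the minima above is taken over an empty collection *)

Lemma increasing_geq f : increasing f -> forall n, n <= f n.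
Proof.
move=> finc; elim=> // n IH; apply: leq_ltn_trans IH _.
exact: finc.
Qed.

Lemma covers_singletons f : increasing f ->
  covers (yorioka_I f) [set [set x] | x in [set: cantor]].
Proof.
move=> finc; split; last first.
  by apply/seteqP; split=> // x _; exists [set x] => //; exists x.
have fle m n : m <= n -> f m <= f n.
  by rewrite leq_eqVlt => /orP[/eqP->//|/finc/ltnW].
move=> _ [x _ <-]; exists (fun n => f (n ^ n)).
  move=> k; exists (maxn 1 k) => n; rewrite geq_max => /andP[n1 kn].
  by apply: fle; exact: leq_pexp2l.
exists (fun n => mkseq x (f (n ^ n))); split.
  move=> _ -> m; exists m => // i; rewrite size_mkseq => ilt.
  by rewrite nth_mkseq.
by apply/funext => i; rewrite /height size_mkseq.
Qed.

Lemma not_yorioka_setT f : increasing f -> ~ yorioka_I f [set: cantor].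
Proof.
move=> finc [g fg [sigma [sub hg]]].
have [m0 hm] := fg 2.
pose x n := ~~ nth false (sigma n) n.
have /(_ (maxn 2 m0)) [n] := sub x I.
rewrite geq_max => /andP[n2 mn] /(_ n).
have gn : n < size (sigma n).
  have -> : size (sigma n) = g n by rewrite -hg.
  apply: leq_trans (hm _ mn).
  apply: leq_trans (increasing_geq finc _).
  by rewrite -[X in X < _]muln1 expnS expn1 ltn_pmul2l // ltnW.
by move=> /(_ gn); rewrite /x; case: nth.
Qed.

Lemma aLc_unbounded_slalom1 b : aLc_unbounded b (slalom1 b).
Proof.
split=> // -[x xb /(_ (fun n => [set x n]))]; case.
  move=> n; split=> [_ -> /=|]; first exact: xb.
  by rewrite (card_le_eql card_set1).
by move=> m /(_ m (leqnn m)); apply.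
Qed.

Lemma aLc_dominating_const2 : aLc_dominating (fun=> 2) (prodb (fun=> 2)).
Proof.
split=> // phi sphi.
exists (fun n => `[< ~ phi n 1 >] : nat).
  by move=> n; case: asbool.
exists 0 => n _; case: asboolP => //= n1 p0.
have [_ /card_leP[g]] := sphi n.
have p1 : phi n 1 by apply: contrapT.
pose u0 : phi n := SigSub (mem_set p0).
pose u1 : phi n := SigSub (mem_set p1).
have : g u0 = g u1.
  apply: val_inj => /=.
  have := set_mem (svalP (g u0)); have := set_mem (svalP (g u1)).
  rewrite /=; case: (sval (g u0)) (sval (g u1)) => [|?] [|?] //.
move=> /(@inj _ _ _ g _ _ (mem_setT _) (mem_setT _)).
by move=> /(congr1 val).
Qed.

Lemma supcov_bounded f : increasing f ->
  cardinal_le (cov (yorioka_I f)) (card [set: set cantor]).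
Proof.
move=> finc.
have := @cardinal_minP (fun k => exists2 F, covers (yorioka_I f) F & k = card F)
  _ (ex_intro2 _ _ _ (covers_singletons finc) erefl).
rewrite -/(cov _) => -[[F _ ->] _].
by apply/cardinal_leE; exact: subset_card_le.
Qed.

Lemma supaLc_bounded b :
  cardinal_le (b_aLc b) (card [set: nat -> set nat]).
Proof.
have := @cardinal_minP (fun k => exists2 F, aLc_unbounded b F & k = card F)
  _ (ex_intro2 _ _ _ (aLc_unbounded_slalom1 b) erefl).
rewrite -/(b_aLc _) => -[[F _ ->] _].
by apply/cardinal_leE; exact: subset_card_le.
Qed.

(* Main.v *)
(** Both equalities come from two Tukey connections between the membership
    relation of a Yorioka ideal and anti-localization.
    Given [f], pick [g >> f] and let [b n] bound the codes of the binary strings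
    of length [g n]: sending [x] to the codes of its restrictions [x | g n] turns
    one-point slaloms for [b] into sequences of strings of height [g].
    Given [b], code [y \in prodb b] by the characteristic function of its graph
    and let [f] grow so fast that [x | f n] reveals [y n]: a string of length at
    least [f n] then guesses a single value at [n]. *)
From mathcomp Require Import all_boot.
From mathcomp Require Import boolp classical_sets functions cardinality.
Require Import Defs.

Set Implicit Arguments.
Unset Strict Implicit.
Unset Printing Implicit Defensive.

Local Open Scope nat_scope.
Local Open Scope classical_set_scope.
Local Open Scope card_scope.

Lemma card_le_I1P (T : Type) (A : set T) :
  A #<= `I_1 <-> forall u v, A u -> A v -> u = v.
Proof.
split=> [/card_leP[g] u v Au Av|Asub].
  pose u0 : A := SigSub (mem_set Au).
  pose v0 : A := SigSub (mem_set Av).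
  have : g u0 = g v0.
    apply: val_inj => /=.
    have := set_mem (svalP (g u0)); have := set_mem (svalP (g v0)).
    by rewrite /=; case: (sval (g u0)) (sval (g v0)) => [|?] [|?].
  by move=> /(@inj _ _ _ g _ _ (in_setT _) (in_setT _)) /(congr1 val).
have [->|/set0P[u Au]] := eqVneq A set0; first exact: card_ge0.
have -> : A = [set u].
  by apply/seteqP; split=> [v Av|_ ->//]; exact: Asub.
by rewrite (card_le_eql card_set1).
Qed.

Lemma cardinal_min_le (S : cardinal -> Prop) (k : cardinal) :
  S k -> cardinal_le (cardinal_min S) k.
Proof. by move=> Sk; have [_ /(_ _ Sk)] := cardinal_minP Sk. Qed.

(** Inhabitedness of [S'] makes its minimum a genuine least element rather than the junk value; that
    element lies above some member of [S]. *)
Lemma cardinal_min_mono (S S' : cardinal -> Prop) :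
    (exists k, S' k) ->
    (forall k, S' k -> exists2 l, S l & cardinal_le l k) ->
  cardinal_le (cardinal_min S) (cardinal_min S').
Proof.
move=> [k S'k] SS'; have [/SS'[l Sl lk] _] := cardinal_minP S'k.
exact: cardinal_le_trans (cardinal_min_le Sl) lk.
Qed.

(** A supremum is the minimum of the upper bounds, and [m] witnesses that [S'] has one. *)
Lemma cardinal_sup_mono (S S' : cardinal -> Prop) (m : cardinal) :
    (forall l, S' l -> cardinal_le l m) ->
    (forall k, S k -> exists2 l, S' l & cardinal_le k l) ->
  cardinal_le (cardinal_sup S) (cardinal_sup S').
Proof.
move=> S'm SS'; apply: cardinal_min_mono; first by exists m.
move=> k S'k; exists k => [l /SS'[l' S'l' ll']|].
  exact: cardinal_le_trans ll' (S'k _ S'l').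
by case: (cardinalE k) => T ->; apply/cardinal_leE; exact: card_lexx.
Qed.

Lemma cardinal_min_attained (T : Type) (P : set T -> Prop) (A : set T) :
  P A ->
  exists2 B, P B & cardinal_min (fun k => exists2 B, P B & k = card B) = card B.
Proof.
move=> PA; pose S k := exists2 B, P B & k = card B.
have SA : S (card A) by exists A.
by case: (cardinal_minP SA).
Qed.

Lemma not_avoids x phi : ~ avoids x phi <->
  infinitely_often (fun n => phi n (x n)).
Proof.
split=> [nav m|io [m mP]]; last by have [n /mP] := io m.
apply: contrapT => nm; apply: nav; exists m => n mn phin.
by apply: nm; exists n.
Qed.

Lemma much_less_diag f : increasing f -> much_less f (fun n => f (n ^ n)).
Proof.
move=> finc k; exists (maxn 1 k) => n; rewrite geq_max => /andP[n1 kn].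
have : n ^ k <= n ^ n by exact: leq_pexp2l.
by rewrite leq_eqVlt => /orP[/eqP->//|/finc/ltnW].
Qed.

(** Consequently [rho] carries unbounded families to covers, and [psi] carries sets outside the
    ideal to dominating families. *)
Lemma tukey_yorioka_aLc f : increasing f ->
  exists b (psi : cantor -> nat -> nat) (rho : (nat -> set nat) -> set cantor),
  [/\ forall x, prodb b (psi x),
      forall phi, slalom1 b phi -> yorioka_I f (rho phi) &
      forall x phi, slalom1 b phi -> ~ avoids (psi x) phi -> rho phi x].
Proof.
move=> finc; pose g n := f (n ^ n).
(* The default string has length [g n], so the height is [g] even where [phi n] codes no string of
   that length. *)
pose sigma (phi : nat -> set nat) n : seq bool :=
  xget (nseq (g n) false) [set s | size s = g n /\ phi n (pickle s)].
exists (fun n => (\max_(t : (g n).-tuple bool) pickle (tval t)).+1).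
exists (fun x n => pickle (mkseq x (g n))), (fun phi => infty_cap (sigma phi)).
split=> [x n|phi sphi|x phi sphi /not_avoids io m].
- have sz : size (mkseq x (g n)) == g n by rewrite size_mkseq.
  rewrite ltnS; exact: (leq_bigmax (Tuple sz)).
- exists g; first exact: much_less_diag.
  exists (sigma phi); split=> //; apply/funext => n.
  rewrite /height /sigma; case: xgetP => [s -> []//|_].
  exact: size_nseq.
have [n mn phin] := io m; exists n => //.
suff -> : sigma phi n = mkseq x (g n).
  by move=> i; rewrite size_mkseq => ig; rewrite nth_mkseq.
(* A one-point slalom contains a single code and [pickle] is injective, so the chosen string can
   only be the restriction of [x]. *)
rewrite /sigma; case: xgetP => [s _ [_ phis]|/(_ (mkseq x (g n)))[]].
  have [_ /card_le_I1P phi1] := sphi n.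
  exact/(pcan_inj pickleK)/(phi1 _ _ phis phin).
by split=> //; exact: size_mkseq.
Qed.

(** Consequently [rho] carries covers to unbounded families, and [psi] carries dominating families
    to sets outside the ideal. *)
Lemma tukey_aLc_yorioka b :
  exists2 f, increasing f &
  exists (psi : (nat -> nat) -> cantor) (rho : set cantor -> nat -> set nat),
  [/\ forall A, yorioka_I f A -> slalom1 b (rho A) &
      forall y A, prodb b y -> yorioka_I f A -> A (psi y) ->
        ~ avoids y (rho A)].
Proof.
(* The inner sum puts [f n] above every code of [(n, j)] with [j < b n]; the outer successor keeps
   [f] strictly increasing where [b] vanishes. *)
pose f n :=
  \sum_(i < n.+1) (\sum_(j < b i) (pickle (val i, val j)).+1).+1.
have fS n : f n < f n.+1.
  by rewrite /f [X in _ < X]big_ord_recr /= addnS ltnS leq_addr.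
have finc : increasing f by exact: homo_ltn ltn_trans fS.
have code_lt n j : j < b n -> pickle (n, j) < f n.
  move=> jb; rewrite /f big_ord_recr /= (bigD1 (Ordinal jb)) //=.
  by rewrite addnS ltnS addnCA ltnW // leq_addr.
exists f => //.
(* The bits of [sigma n] at the codes of [(n, k)] must be the characteristic function of a
   singleton; its element is the guess, and otherwise nothing is guessed. *)
pose phi (sigma : nat -> seq bool) n : set nat :=
  [set j | j < b n /\ forall k, k < b n ->
    nth false (sigma n) (pickle (n, k)) = (k == j)].
pose sigma A : nat -> seq bool := xget (fun=> [::])
  [set s | A `<=` infty_cap s /\ much_less f (height s)].
exists (fun y m => if unpickle m is Some (n, j) then j == y n else false).
exists (fun A => phi (sigma A)); split=> [A _ n|y A yb [g fg [s [As sg]]] Ay].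
  split=> [j []//|]; apply/card_le_I1P => u v [ub uP] [vb vP].
  by apply/eqP; rewrite -(vP _ ub) uP.
have [Asig fsig] : A `<=` infty_cap (sigma A) /\ much_less f (height (sigma A)).
  by rewrite /sigma; case: xgetP => [s0 _ []//|/(_ s)[]]; split; rewrite ?sg.
(* Exponent [1] yields length at least [f n] for almost all [n], enough to contain all the bits that
   [phi] reads. *)
apply/not_avoids => m; have [m1 m1P] := fsig 1.
have [n] := Asig _ Ay (maxn m m1).
rewrite geq_max => /andP[mn m1n] seg; exists n => //; split; first exact: yb.
move=> k kb; rewrite seg; first by rewrite pickleK.
by apply: leq_trans (code_lt _ _ kb) _; have := m1P _ m1n; rewrite expn1.
Qed.

Lemma cov_le_b_aLc f : increasing f ->
  exists b, cardinal_le (cov (yorioka_I f)) (b_aLc b).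
Proof.
move=> finc; have [b [psi [rho [psib rhoI tukey]]]] := tukey_yorioka_aLc finc.
exists b; rewrite /b_aLc.
have [F [Fb Funb] ->] := cardinal_min_attained (aLc_unbounded_slalom1 b).
apply: (@cardinal_le_trans _ (card (rho @` F))); last first.
  by apply/cardinal_leE; exact: card_image_le.
apply: cardinal_min_le; exists (rho @` F) => //; split.
  by move=> _ [phi Fphi <-]; exact/rhoI/Fb.
(* For an uncovered [x], [psi x] would avoid every slalom in [F]. *)
apply/seteqP; split=> // x _; apply: contrapT => nx; apply: Funb.
exists (psi x) => // phi Fphi; apply: contrapT => nav; apply: nx.
by exists (rho phi); [exists phi | apply: tukey nav; exact: Fb].
Qed.

Lemma d_aLc_le_non f : increasing f ->
  exists2 b, (exists D, aLc_dominating b D) &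
    cardinal_le (d_aLc b) (non (yorioka_I f)).
Proof.
move=> finc; have [b [psi [rho [psib rhoI tukey]]]] := tukey_yorioka_aLc finc.
rewrite /non; have [A nA ->] :=
  cardinal_min_attained (P := fun A => ~ yorioka_I f A) (not_yorioka_setT finc).
have dom : aLc_dominating b (psi @` A).
  split=> [_ [x _ <-]//|phi sphi]; apply: contrapT => nav; apply: nA.
  have [g fg [s [rs sg]]] := rhoI _ sphi.
  exists g => //; exists s; split=> // x Ax; apply: rs; apply: tukey => // av.
  by apply: nav; exists (psi x) => //; exists x.
exists b; first by exists (psi @` A).
apply: (@cardinal_le_trans _ (card (psi @` A))).
  by apply: cardinal_min_le; exists (psi @` A).
by apply/cardinal_leE; exact: card_image_le.
Qed.

Lemma b_aLc_le_cov b :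
  exists2 f, increasing f & cardinal_le (b_aLc b) (cov (yorioka_I f)).
Proof.
have [f finc [psi [rho [rhob tukey]]]] := tukey_aLc_yorioka b.
exists f => //; rewrite /cov.
have [F [FI Fcov] ->] := cardinal_min_attained (covers_singletons finc).
apply: (@cardinal_le_trans _ (card (rho @` F))); last first.
  by apply/cardinal_leE; exact: card_image_le.
apply: cardinal_min_le; exists (rho @` F) => //; split.
  by move=> _ [A FA <-]; exact/rhob/FI.
move=> [y yb yav]; have [A FA Ay] : (\bigcup_(A in F) A) (psi y) by rewrite Fcov.
by apply: (tukey _ _ yb (FI _ FA) Ay); apply: yav; exists A.
Qed.

Lemma non_le_d_aLc b : (exists D, aLc_dominating b D) ->
  exists2 f, increasing f & cardinal_le (non (yorioka_I f)) (d_aLc b).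
Proof.
move=> [D0 domb]; have [f finc [psi [rho [rhob tukey]]]] := tukey_aLc_yorioka b.
exists f => //; rewrite /d_aLc.
have [D [Db Ddom] ->] := cardinal_min_attained domb.
apply: (@cardinal_le_trans _ (card (psi @` D))); last first.
  by apply/cardinal_leE; exact: card_image_le.
apply: cardinal_min_le; exists (psi @` D) => // ID.
(* Were the image of [D] in the ideal, some [y] in [D] would avoid the slalom assigned to that
   image, although [psi y] belongs to it. *)
have [y Dy] := Ddom _ (rhob _ ID).
by apply: tukey (Db _ Dy) ID _; exists y.
Qed.

Theorem theorem3p17 : supcov = supaLc /\ minnon = minaLc.
Proof.
split; apply: cardinal_le_anti.
- apply: (@cardinal_sup_mono _ _ (card [set: nat -> set nat])).
    by move=> _ [b ->]; exact: supaLc_bounded.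
  move=> _ [f finc ->]; have [b fb] := cov_le_b_aLc finc.
  by exists (b_aLc b) => //; exists b.
- apply: (@cardinal_sup_mono _ _ (card [set: set cantor])).
    by move=> _ [f finc ->]; exact: supcov_bounded.
  move=> _ [b ->]; have [f finc bf] := b_aLc_le_cov b.
  by exists (cov (yorioka_I f)) => //; exists f.
- apply: cardinal_min_mono.
    (* With two values available at each [n], a one-point slalom always leaves one free, so the
       minimum defining [minaLc] ranges over an inhabited collection. *)
    exists (d_aLc (fun=> 2)); exists (fun=> 2) => //.
    by exists (prodb (fun=> 2)); exact: aLc_dominating_const2.
  move=> _ [b domb ->]; have [f finc fb] := non_le_d_aLc domb.
  by exists (non (yorioka_I f)) => //; exists f.
- apply: cardinal_min_mono.
    by exists (non (yorioka_I id)); exists id.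
  move=> _ [f finc ->]; have [b domb bf] := d_aLc_le_non finc.
  by exists (d_aLc b) => //; exists b.
Qed.
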